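(* Let $\alpha,\beta\in\mathbb R$ and let $\mathcal K,M_1,M_2$ be elements of a unital associative algebra (with unit $\mathcal I$) satisfying the circle Jacobi algebra relations $$M_1^2=M_2^2=\mathcal I,\qquad \{\mathcal K,M_1\}=(\alpha+\beta+1)(M_1-\mathcal I),\qquad \{\mathcal K,M_2\}=(\alpha+\beta+2)M_2+(\alpha-\beta)\mathcal I .$$ Put $$X=M_2M_1+M_1M_2,\qquad Y=\mathcal K^2-(\alpha+\beta+1)\mathcal K .$$ Then $X$ and $Y$ both commute with $M_1$, and they satisfy the relations of a central extension of the quadratic Jacobi algebra: $$[X,[X,Y]]=2X^2-8\,\mathcal I,$$ $$[Y,[Y,X]]=2\{X,Y\}+(\alpha+\beta)(\alpha+\beta+2)X+2(\beta-\alpha)M_1+2(\alpha-\beta)(\alpha+\beta+1)\,\mathcal I .$$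
   Context: $\{A,B\}=AB+BA$ denotes the anticommutator and $[A,B]=AB-BA$ the commutator; the algebra is over a field containing $\mathbb R$ (e.g. $\mathbb R$ or $\mathbb C$). The quadratic Jacobi algebra is the algebra with two generators $K_1,K_2$ and relations $[K_1,[K_1,K_2]]=aK_1^2+dK_1+e_1\mathcal I$ and $[K_2,[K_2,K_1]]=a\{K_1,K_2\}+cK_1+dK_2+e_2\mathcal I$ with structure constants $a,c,d,e_1,e_2$; the phrase ''central extension'' refers to the extra term proportional to $M_1$, which commutes with both $X$ and $Y$. *)

(* Defs.v *)
From mathcomp Require Export all_boot all_order all_algebra.
From mathcomp Require Export reals.
Set Implicit Arguments.
Unset Strict Implicit.
Unset Printing Implicit Defensive.
Import GRing.Theory.
Local Open Scope ring_scope.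

Definition lie {A : pzRingType} (x y : A) : A := x * y - y * x.
Definition anti {A : pzRingType} (x y : A) : A := x * y + y * x.

(* Main.v *)
Require Import Defs.
From Stdlib Require Ncring Ncring_tac.
From mathcomp Require Import ring.
Import GRing.Theory.
Local Open Scope ring_scope.

(** Shift [K] by half of [alpha + beta + 1] to [L], so that [{L, M1}] is a
    scalar, [{L, M2}] is [M2] plus a scalar, and [Y] is [L ^+ 2] minus a
    scalar.  Since [[L^2, Z] = [L, {L, Z}]], [ad Y] kills [M1] and agrees with
    [ad L] on [M2].  As [X] commutes with both [M1] and [M2], the rest follows
    from the derivation rules: [[Y, X] = {[L, M2], M1}] and [[X, L] = [M1, M2]]. *)

(** These instances hand MathComp rings, with Leibniz equality, to [non_commutative_ring]. *)
#[local] Instance pzRing_Ncring_ops (A : pzRingType) :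
  @Ncring.Ring_ops A 0 1 +%R *%R (fun x y => x - y) -%R eq := {}.

#[local] Instance pzRing_Ncring (A : pzRingType) :
  Ncring.Ring (Ro := pzRing_Ncring_ops A).
Proof.
split; try exact _.
- exact: add0r.
- exact: addrC.
- exact: addrA.
- exact: mul1r.
- exact: mulr1.
- exact: mulrA.
- exact: mulrDl.
- by move=> x y z; apply: mulrDr.
- by [].
- exact: addrN.
Qed.

Ltac nc_ring :=
  rewrite /lie /anti ?(mulrS, mulr0n, expr2); Ncring_tac.non_commutative_ring.

Section LieAnti.
Set Implicit Arguments.
Unset Strict Implicit.
Variable A : pzRingType.
Implicit Types x y z c : A.

Lemma lie_sqrl x y : lie (x ^+ 2) y = lie x (anti x y).
Proof. nc_ring. Qed.

Lemma lie_anti x y z :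
  lie x (anti y z) = anti (lie x y) z + anti y (lie x z).
Proof. nc_ring. Qed.

Lemma lie_jacobi x y z :
  lie x (lie y z) = lie (lie x y) z + lie y (lie x z).
Proof. nc_ring. Qed.

(** Trades a double commutator for anticommutators, the form in which the relation between [L] and
    [M2] is given. *)
Lemma lie_lie x y :
  lie x (lie x y) = anti (x ^+ 2) y *+ 2 - anti x (anti x y).
Proof. nc_ring. Qed.

Lemma lie_oppr x y : lie x (- y) = - lie x y.
Proof. nc_ring. Qed.

Lemma lie_opp x y : lie y x = - lie x y.
Proof. nc_ring. Qed.

Lemma antiC x y : anti x y = anti y x.
Proof. nc_ring. Qed.

Lemma anti0r x : anti x 0 = 0.
Proof. by rewrite /anti mulr0 mul0r addr0. Qed.

(** The two sides differ by [lie x (lie z y)]. With [z = L ^+ 2], [x = M2], [y = M1], nested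
    anticommutators reassemble into one with [X]. *)
Lemma anti_anti_comm x y z :
  lie z y = 0 -> anti (anti z x) y = anti z (anti x y).
Proof.
move=> zy.
have -> : anti (anti z x) y = anti z (anti x y) + lie x (lie z y) by nc_ring.
by rewrite zy /lie mulr0 mul0r subr0 addr0.
Qed.

(** Scalars are modelled as central elements, so that the computation below uses ring operations
    only. *)
Definition central c := forall x, lie c x = 0.

Lemma lie_centralr c x : central c -> lie x c = 0.
Proof. by move=> hc; rewrite lie_opp hc oppr0. Qed.

End LieAnti.

Section ShiftedCircleJacobi.
Set Implicit Arguments.
Unset Strict Implicit.
Variables (A : pzRingType) (L M1 M2 s u : A).
Hypotheses (hM1 : M1 ^+ 2 = 1) (hM2 : M2 ^+ 2 = 1).
Hypotheses (s_central : central s) (u_central : central u).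
Hypotheses (hL1 : anti L M1 = - s) (hL2 : anti L M2 = M2 + u).
Let X := anti M2 M1.

(** The terms [M1 * M2 * M1] cancel, leaving a commutator with [M1 ^+ 2 = 1]. *)
Lemma circle_lie_X_M1 : lie X M1 = 0.
Proof.
have -> : lie X M1 = lie M2 (M1 ^+ 2) by rewrite /X; nc_ring.
by rewrite hM1; nc_ring.
Qed.

Lemma circle_lie_X_M2 : lie X M2 = 0.
Proof.
have -> : lie X M2 = lie M1 (M2 ^+ 2) by rewrite /X; nc_ring.
by rewrite hM2; nc_ring.
Qed.

Lemma circle_lie_sqr_M1 : lie (L ^+ 2) M1 = 0.
Proof. by rewrite lie_sqrl hL1 lie_oppr lie_centralr ?oppr0. Qed.

Lemma circle_lie_sqr_M2 : lie (L ^+ 2) M2 = lie L M2.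
Proof.
rewrite lie_sqrl hL2.
have -> : lie L (M2 + u) = lie L M2 + lie L u by nc_ring.
by rewrite (lie_centralr L u_central) addr0.
Qed.

Lemma circle_lie_sqr_X : lie (L ^+ 2) X = anti (lie L M2) M1.
Proof.
by rewrite lie_anti circle_lie_sqr_M1 circle_lie_sqr_M2 anti0r addr0.
Qed.

Lemma circle_lie_X_L : lie X L = lie M1 M2.
Proof.
have -> : lie X L = M2 * anti L M1 - anti L M2 * M1
                    + M1 * anti L M2 - anti L M1 * M2 by rewrite /X; nc_ring.
rewrite hL1 hL2.
transitivity (lie M1 M2 + lie s M2 - lie u M1); first nc_ring.
by rewrite s_central u_central subr0 addr0.
Qed.

Lemma circle_lie_X_lie_X_sqr :
  lie X (lie X (L ^+ 2)) = X ^+ 2 *+ 2 - 1 *+ 8.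
Proof.
rewrite [lie X (L ^+ 2)]lie_opp circle_lie_sqr_X lie_oppr lie_anti.
rewrite circle_lie_X_M1 anti0r addr0.
rewrite lie_jacobi circle_lie_X_L circle_lie_X_M2.
have -> : lie (lie M1 M2) M2 =
    anti M1 (M2 ^+ 2) + (M2 ^+ 2 * M1) *+ 2 - (M2 * X) *+ 2.
  by rewrite /X; nc_ring.
rewrite hM2.
(* Moving [X] past [M1] turns [M2 * X * M1 + M1 * M2 * X] into [X ^+ 2], up to [M2 * lie X M1]. *)
transitivity (X ^+ 2 *+ 2 + M2 * lie X M1 *+ 2 - M1 ^+ 2 *+ 8).
  by rewrite /X; nc_ring.
by rewrite circle_lie_X_M1 hM1 mulr0 mul0rn addr0.
Qed.

Lemma circle_lie_sqr_lie_sqr_X :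
  lie (L ^+ 2) (lie (L ^+ 2) X) =
    anti X (L ^+ 2) *+ 2 - X - u * M1 *+ 2 + u * s *+ 2.
Proof.
rewrite circle_lie_sqr_X lie_anti circle_lie_sqr_M1 anti0r addr0.
(* As [L ^+ 2] commutes with [L], only [lie L (lie L M2)] survives. *)
rewrite lie_jacobi circle_lie_sqr_M2.
have -> : lie (L ^+ 2) L = 0 by nc_ring.
have -> : lie 0 M2 = 0 by nc_ring.
rewrite add0r lie_lie hL2.
have -> : anti L (M2 + u) = anti L M2 + (u * L) *+ 2 - lie u L by nc_ring.
rewrite u_central hL2.
(* The term in [anti L M1 = - s] yields the constant [u * s *+ 2]; the commutators with [u]
   vanish. *)
transitivity (anti (anti (L ^+ 2) M2) M1 *+ 2 - X - u * M1 *+ 2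
   - u * anti L M1 *+ 2 + lie u M1 + (lie u M1 * L) *+ 2).
  by rewrite /X; nc_ring.
rewrite u_central mul0r mul0rn !addr0 hL1 mulrN mulNrn opprK.
by rewrite anti_anti_comm ?circle_lie_sqr_M1 // -/X antiC.
Qed.
End ShiftedCircleJacobi.

Lemma scalar_central (F : pzRingType) (A : algType F) (a : F) :
  central (a *: 1 : A).
Proof. by move=> x; rewrite /lie -scalerAl -scalerAr mul1r mulr1 subrr. Qed.

(* iota : R -> F expresses that the base field F contains the reals *)
Theorem mainTheorem4 (R : realType) (F : fieldType) (iota : {rmorphism R -> F})
    (A : algType F) (alpha beta : R) (K M1 M2 : A)
    (hM1 : M1 ^+ 2 = 1) (hM2 : M2 ^+ 2 = 1)
    (hKM1 : anti K M1 = iota (alpha + beta + 1) *: (M1 - 1))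
    (hKM2 : anti K M2 =
      iota (alpha + beta + 2) *: M2 + iota (alpha - beta) *: 1) :
  let X := M2 * M1 + M1 * M2 in
  let Y := K ^+ 2 - iota (alpha + beta + 1) *: K in
  [/\ lie X M1 = 0,
      lie Y M1 = 0,
      lie X (lie X Y) = 2 *: X ^+ 2 - 8 *: 1 &
      lie Y (lie Y X) =
        2 *: anti X Y
        + iota ((alpha + beta) * (alpha + beta + 2)) *: X
        + iota (2 * (beta - alpha)) *: M1
        + iota (2 * (alpha - beta) * (alpha + beta + 1)) *: 1].
Proof.
move=> X Y.
(* Halving is done in [R], where 2 is known to be nonzero. *)
pose sigma := iota (alpha + beta + 1); pose c := iota ((alpha + beta + 1) / 2).
pose nu := iota (alpha - beta).
have sigmaE : sigma = c *+ 2.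
  by rewrite -rmorphMn /= -mulr_natr divfK // Num.Theory.pnatr_eq0.
pose L := K - c *: 1.
have LantiE Z : anti L Z = anti K Z - sigma *: Z.
  rewrite sigmaE /anti /L mulrBl mulrBr -scalerAl -scalerAr mul1r mulr1.
  by rewrite mulr2n scalerDl opprD addrACA.
have hL1 : anti L M1 = - (sigma *: 1).
  by rewrite LantiE hKM1 -/sigma scalerBr addrAC subrr add0r.
have hL2 : anti L M2 = M2 + nu *: 1.
  rewrite LantiE hKM2 addrAC -scalerBl -rmorphB /=.
  have -> : alpha + beta + 2 - (alpha + beta + 1) = 1 by ring.
  by rewrite rmorph1 scale1r.
have YE : Y = L ^+ 2 - (c ^+ 2) *: 1.
  have cC : (c ^+ 2) *: 1 = (c *: 1) ^+ 2 :> A by rewrite exprZn expr1n.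
  transitivity (K ^+ 2 - (c *: 1) * K *+ 2 + lie (c *: 1) K).
    rewrite scalar_central addr0 /Y -/sigma sigmaE.
    by rewrite -scalerAl mul1r mulr2n scalerDl -mulr2n.
  by rewrite cC /L; nc_ring.
have lieYE Z : lie Y Z = lie (L ^+ 2) Z.
  transitivity (lie (L ^+ 2) Z - lie ((c ^+ 2) *: 1) Z); first by rewrite YE; nc_ring.
  by rewrite scalar_central subr0.
have sC := @scalar_central _ A sigma; have nC := @scalar_central _ A nu.
have X1 := circle_lie_X_M1 M2 hM1.
split=> //.
- by rewrite lieYE (circle_lie_sqr_M1 sC hL1).
(* [lieYE] needs [Y] on the left, hence the two sign flips. *)
- rewrite [lie X Y]lie_opp lieYE -lie_opp.
  rewrite (circle_lie_X_lie_X_sqr hM1 hM2 sC nC hL1 hL2).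
  by rewrite !scaler_nat.
- rewrite !lieYE (circle_lie_sqr_lie_sqr_X sC nC hL1 hL2).
  (* Returning to [Y] makes the coefficient of [X] equal to [4 c^2 - 1 = sigma^2 - 1], the image of
     [(alpha + beta) * (alpha + beta + 2)]. *)
  have -> : L ^+ 2 = Y + (c ^+ 2) *: 1 by rewrite YE subrK.
  rewrite -[anti M2 M1]/X.
  have -> : anti X (Y + c ^+ 2 *: 1) = anti X Y + (c ^+ 2 *+ 2) *: X.
    transitivity (anti X Y + (c ^+ 2 *: 1) * X *+ 2 - lie (c ^+ 2 *: 1) X).
      by nc_ring.
    by rewrite scalar_central subr0 -scalerAl mul1r mulr2n -scalerDl -mulr2n.
  rewrite mulrnDl -!scalerAl !mul1r -!scaler_nat !scalerA.
  have -> : iota ((alpha + beta) * (alpha + beta + 2)) = 2 * (c ^+ 2 *+ 2) - 1.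
    have -> : 2 * (c ^+ 2 *+ 2) = sigma ^+ 2 by rewrite sigmaE; ring.
    by rewrite -rmorphXn -(rmorph1 iota) -rmorphB; congr (iota _); ring.
  have -> : iota (2 * (beta - alpha)) = - (2 * nu).
    by rewrite -opprB mulrN rmorphN rmorphM /= rmorph_nat.
  have -> : iota (2 * (alpha - beta) * (alpha + beta + 1)) = 2 * nu * sigma.
    by rewrite !rmorphM /= rmorph_nat.
  by rewrite scalerBl scale1r scaleNr addrA.
Qed.
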